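(* Let $G$ be a graph with vertex set $[n]=\{1,\ldots,n\}$ and clique number $\omega=\omega(G)$. Then for every $\mathbf{x}=(x_1,\ldots,x_n)\in\mathbb{R}^n$ with $\mathbf{x}\ge 0$, $$\rho_1(G,\mathbf{x})\ \ge\ \rho_2(G,\mathbf{x})^{1/2}\ \ge\ \cdots\ \ge\ \rho_\omega(G,\mathbf{x})^{1/\omega}.$$
   Context: Graphs are finite, simple and undirected, with vertex set $[n]=\{1,\ldots,n\}$, $n\ge 1$. An $s$-clique of $G$ is a set of $s$ pairwise adjacent vertices; $K_s(G)$ denotes the set of $s$-cliques of $G$, and $\omega(G)$ is the size of a largest clique of $G$. For $\mathbf{x}=(x_1,\ldots,x_n)\in\mathbb{R}^n$ and $1\le s\le\omega=\omega(G)$, define $$f_s(G,\mathbf{x})=\sum_{\{i_1,\ldots,i_s\}\in K_s(G)}x_{i_1}\cdots x_{i_s},\qquad \rho_s(G,\mathbf{x})=f_s(G,\mathbf{x})\binom{\omega}{s}^{-1}.$$ The notation $\mathbf{x}\ge 0$ means that all coordinates of $\mathbf{x}$ are nonnegative. *)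

(* Defs.v *)
From HB Require Import structures.
From mathcomp Require Import all_boot all_order all_algebra.
From mathcomp Require Import all_classical all_reals all_analysis.
Set Implicit Arguments.
Unset Strict Implicit.
Unset Printing Implicit Defensive.
Import Order.TTheory GRing.Theory Num.Theory.
Local Open Scope ring_scope.

(* The vertex set [n] = {1, ..., n} is encoded as 'I_n = {0, ..., n - 1}. *)
Record sgraph (n : nat) := SGraph {
  adj :> rel 'I_n;
  adj_sym : symmetric adj;
  adj_irrefl : irreflexive adj
}.

Definition is_clique (n : nat) (G : sgraph n) (A : {set 'I_n}) : bool :=
  [forall i in A, forall j in A, (i != j) ==> G i j].

Definition cliques (n : nat) (G : sgraph n) (s : nat) : {set {set 'I_n}} :=
  [set A : {set 'I_n} | is_clique G A & #|A| == s].

Definition clique_number (n : nat) (G : sgraph n) : nat :=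
  (\max_(A : {set 'I_n} | is_clique G A) #|A|)%N.

Definition clique_sum (R : realType) (n : nat) (G : sgraph n) (s : nat)
    (x : 'rV[R]_n) : R :=
  \sum_(A in cliques G s) \prod_(i in A) x ord0 i.

Definition clique_density (R : realType) (n : nat) (G : sgraph n) (s : nat)
    (x : 'rV[R]_n) : R :=
  clique_sum G s x / 'C(clique_number G, s)%:R.

(* Main.v *)
Require Import Defs.
From HB Require Import structures.
From mathcomp Require Import all_boot all_order all_algebra.
From mathcomp Require Import all_classical all_reals all_analysis.
From mathcomp Require Import zify ring lra.
Set Implicit Arguments.
Unset Strict Implicit.
Unset Printing Implicit Defensive.
Import Order.TTheory GRing.Theory Num.Theory.
Local Open Scope ring_scope.

(** The inequality between consecutive densities follows from the case in which
    the nonzero coordinates of [x] span a clique.  If [i] and [j] are not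
    adjacent, no clique contains both, so every clique sum is affine in the pair
    [(x_i, x_j)], without a product term.  On the set of nonnegative pairs where
    the [s]-clique sum has its given value, the [(s+1)]-clique sum is therefore
    affine too.  When the [s]-clique sum has positive derivatives in [x_i] and
    [x_j], that set is a segment ending on the axes, and one endpoint does not
    decrease the [(s+1)]-clique sum; when the derivative in one of the two
    coordinates is zero, that coordinate contributes to neither sum.  In all
    cases [x_i] or [x_j] can be made zero ([slide]).  Repeating this, the support
    shrinks until it is a clique ([supp_clique_reduction]).

    Once the support is a clique, it has at most [omega] elements and the clique
    sums are the elementary symmetric polynomials of these coordinates, padded
    with zeros to [omega] variables.  Dividing by ['C(omega, s)] turns them into
    symmetric means ([clique_density_supp]), and the claim becomes Maclaurin's
    inequality ([maclaurin]), a consequence of Newton's inequalities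
    ([newton]). *)

(** * Newton's and Maclaurin's inequalities *)

(** The [k]-th symmetric mean, that is, the [k]-th elementary symmetric
    polynomial of [l] divided by ['C(size l, k)].  The recursion adds one variable
    at a time and avoids dividing by a binomial coefficient, which vanishes for
    [k > size l]; the link is [coef_prod_symmean]. *)
Fixpoint symmean (R : fieldType) (l : seq R) (k : nat) : R :=
  if l is x :: l' then
    ((size l - k)%:R * symmean l' k + k%:R * x * symmean l' k.-1) / (size l)%:R
  else (k == 0)%:R.

Section SymmetricMeans.
Variable R : realFieldType.
Implicit Types (x : R) (l : seq R) (k : nat).

Local Notation nneg l := (all (fun x : R => 0 <= x) l).

Lemma symmean_cons x l k :
  (size l).+1%:R * symmean (x :: l) k =
  ((size l).+1 - k)%:R * symmean l k + k%:R * x * symmean l k.-1.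
Proof. by rewrite /= mulrC divfK // pnatr_eq0. Qed.

Lemma symmean0 l : symmean l 0 = 1.
Proof.
elim: l => //= x l IHl.
by rewrite IHl subn0 !mul0r mulr1 addr0 divff // pnatr_eq0.
Qed.

Lemma symmean_big l k : (size l < k)%N -> symmean l k = 0.
Proof.
elim: l k => [|x l IHl] [|k] //= lt_lk.
by rewrite (IHl k) // (IHl k.+1) ?(ltnW lt_lk) // !mulr0 addr0 mul0r.
Qed.

Lemma symmean_ge0 l k : nneg l -> 0 <= symmean l k.
Proof.
elim: l k => [|x l IHl] k /=; first by rewrite ler0n.
case/andP=> x_ge0 l_ge0.
by rewrite divr_ge0 ?addr_ge0 ?mulr_ge0 ?ler0n ?IHl.
Qed.

(** The sequence of symmetric means has no internal zeros: this replaces the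
    usual reduction to positive variables by a limit. *)
Lemma symmean_eq0S l k : nneg l -> symmean l k = 0 -> symmean l k.+1 = 0.
Proof.
elim: l k => [|x l IHl] k; first by [].
move=> /andP[x_ge0 l_ge0] P0.
have [lt_nk | le_kn] := ltnP (size l) k.
  exact: symmean_big.
have q_ge0 j : 0 <= symmean l j by exact: symmean_ge0.
have qk0 : symmean l k = 0.
  have := symmean_cons x l k; rewrite P0 mulr0 => /esym/eqP.
  rewrite paddr_eq0 ?mulr_ge0 ?ler0n // => /andP[+ _].
  by rewrite mulf_eq0 pnatr_eq0 subSn // => /orP[//|/eqP].
by rewrite /= qk0 (IHl k) // !mulr0 addr0 mul0r.
Qed.

(** Induction on the number of variables.  With [q_j] the means of the tail and
    [x] the new variable, the difference of the two sides, times the squared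
    number of variables, is a square plus nonnegative multiples of differences
    [q_j^2 - q_(j-1) q_(j+1)] and [q_j q_(j+1) - q_(j-1) q_(j+2)].  The last one
    is nonnegative because two instances of the induction hypothesis can be
    multiplied and divided by [q_j q_(j+1)]; if this is zero, so is [q_(j+2)]. *)
Lemma newton l k : nneg l ->
  symmean l k * symmean l k.+2 <= symmean l k.+1 ^+ 2.
Proof.
elim: l k => [|x l IHl] k; first by rewrite mulr0 sqr_ge0.
move=> /andP[x_ge0 l_ge0].
have [le_nk | lt_kn] := leqP (size l) k.
  by rewrite (@symmean_big (x :: l) k.+2) // mulr0 sqr_ge0.
have q_ge0 j : 0 <= symmean l j by exact: symmean_ge0.
have n_gt0 : 0 < (size l).+1%:R ^+ 2 :> R by rewrite exprn_gt0 ?ltr0n.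
rewrite -(ler_pM2l n_gt0) -exprMn expr2 mulrACA !symmean_cons.
have [d ->] : exists d, size l = (d + k.+1)%N.
  by exists (size l - k.+1)%N; rewrite subnK.
have -> : ((d + k.+1).+1 - k = d.+2)%N by lia.
have -> : ((d + k.+1).+1 - k.+1 = d.+1)%N by lia.
have -> : ((d + k.+1).+1 - k.+2 = d)%N by lia.
have S1 m : m.+1%:R = m%:R + 1 :> R by rewrite natr1.
rewrite !(S1 d.+1) !(S1 d) !(S1 k.+1) !(S1 k).
have d_ge0 : 0 <= d%:R :> R by exact: ler0n.
have k_ge0 : 0 <= k%:R :> R by exact: ler0n.
move: (d%:R) d_ge0 => {}d d_ge0.
have weight_ge0 (t u : R) : 0 <= t -> 1 <= u -> 0 <= (t + u) ^+ 2 - 1.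
  by move=> t_ge0 u_ge1; rewrite subr_ge0 -[leLHS](expr1n _ 2) lerXn2r ?nnegrE; lra.
(* When [k = 0] the mean [q_0] of the general case would have index [-1]. *)
case: k lt_kn k_ge0 => [_ _ | k lt_kn].
  have := IHl 0 l_ge0; rewrite /= symmean0 !mul1r => N1.
  rewrite -subr_ge0.
  set q1 := symmean l 1 in N1 *; set q2 := symmean l 2 in N1 *.
  rewrite (_ : _ - _ = (q1 - x) ^+ 2 + ((d + 1) ^+ 2 - 1) * (q1 ^+ 2 - q2));
    last by ring.
  by rewrite addr_ge0 ?sqr_ge0 ?mulr_ge0 ?weight_ge0 ?subr_ge0.
(* From here [q_0, .., q_3] have indices [k, .., k + 3], and [c] is [k + 1]. *)
rewrite /=; move: (k.+1%:R : R) => c c_ge0.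
have N1 := IHl k l_ge0; have N2 := IHl k.+1 l_ge0.
have N3 : symmean l k * symmean l k.+3 <= symmean l k.+1 * symmean l k.+2.
  have [q1_0|q1_neq0] := eqVneq (symmean l k.+1) 0.
    by rewrite (symmean_eq0S l_ge0 (symmean_eq0S l_ge0 q1_0)) q1_0 mulr0 mul0r.
  have [q2_0|q2_neq0] := eqVneq (symmean l k.+2) 0.
    by rewrite (symmean_eq0S l_ge0 q2_0) q2_0 !mulr0.
  have q12_gt0 : 0 < symmean l k.+1 * symmean l k.+2.
    by rewrite mulr_gt0 ?lt0r ?q1_neq0 ?q2_neq0 ?q_ge0.
  rewrite -(ler_pM2l q12_gt0) [leRHS]mulrACA -!expr2.
  have -> : forall a b e f : R, b * e * (a * f) = (a * e) * (b * f).
    by move=> *; ring.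
  by rewrite ler_pM ?mulr_ge0.
move: N1 N2 N3; rewrite -[X in _ -> _ -> _ -> is_true X]subr_ge0.
move: (symmean l k) (symmean l k.+1) (symmean l k.+2) (symmean l k.+3).
move=> q0 q1 q2 q3 N1 N2 N3.
rewrite (_ : _ - _ = (q2 - x * q1) ^+ 2
  + ((d + 1) ^+ 2 - 1) * (q2 ^+ 2 - q1 * q3)
  + ((c + 1) ^+ 2 - 1) * x ^+ 2 * (q1 ^+ 2 - q0 * q2)
  + c * d * x * (q1 * q2 - q0 * q3)); last by ring.
apply: addr_ge0; last by rewrite !mulr_ge0 ?subr_ge0.
apply: addr_ge0; last by rewrite 2?mulr_ge0 ?weight_ge0 ?sqr_ge0 ?subr_ge0.
by rewrite addr_ge0 ?sqr_ge0 ?mulr_ge0 ?weight_ge0 ?subr_ge0.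
Qed.

(** Raise Newton's inequality to the power [k + 1], bound the factor
    [symmean l k ^+ k.+1] below by the induction hypothesis, and cancel
    [symmean l k.+1 ^+ k]. *)
Lemma maclaurin l k : nneg l -> symmean l k.+1 ^+ k <= symmean l k ^+ k.+1.
Proof.
move=> l_ge0; have q_ge0 j : 0 <= symmean l j by exact: symmean_ge0.
elim: k => [|k IHk]; first by rewrite symmean0 !expr1.
have [q1_0|q1_neq0] := eqVneq (symmean l k.+1) 0.
  by rewrite (symmean_eq0S l_ge0 q1_0) q1_0 !expr0n.
have q1_gt0 : 0 < symmean l k.+1 by rewrite lt0r q1_neq0 q_ge0.
have N : (symmean l k * symmean l k.+2) ^+ k.+1 <= symmean l k.+1 ^+ (2 * k.+1).
  by rewrite exprM lerXn2r ?nnegrE ?mulr_ge0 ?exprn_ge0 ?newton.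
rewrite -(ler_pM2l (exprn_gt0 k q1_gt0)) -exprD.
have -> : (k + k.+2 = 2 * k.+1)%N by lia.
apply: le_trans N; rewrite exprMn.
by rewrite ler_wpM2r ?exprn_ge0.
Qed.

Lemma coef_prod_symmean l k :
  (\prod_(x <- l) (1 + x *: 'X))`_k = 'C(size l, k)%:R * symmean l k.
Proof.
elim: l k => [|x l IHl] k.
  by rewrite big_nil coefC; case: k => [|k]; rewrite /= ?mulr1 ?mulr0.
rewrite big_cons mulrDl mul1r -scalerAl coefD coefZ coefXM !IHl.
case: k => [|k]; first by rewrite !symmean0 !bin0 mulr0 addr0.
have n_neq0 : (size l).+1%:R != 0 :> R by rewrite pnatr_eq0.
apply: (mulfI n_neq0); rewrite [RHS]mulrCA symmean_cons subSS /= !mulrDr.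
have down := mul_bin_down (size l).+1 k.+1; rewrite subSS /= in down.
have diag := mul_bin_diag (size l).+1 k; rewrite /= in diag.
congr (_ + _); first by rewrite !mulrA -!natrM down mulnC.
transitivity (x * symmean l k * ((size l).+1 * 'C(size l, k))%:R).
  by rewrite natrM; ring.
by rewrite diag natrM; ring.
Qed.

End SymmetricMeans.

(** * Clique sums and the support of the weights *)

Section CliqueSums.
Variables (R : realType) (n : nat) (G : sgraph n).
Implicit Types (x y : 'rV[R]_n) (i j : 'I_n) (s : nat) (A B : {set 'I_n}).

Definition supp x : {set 'I_n} := [set i | x ord0 i != 0].

(** The partial derivative of the clique sum in the [i]-th coordinate. *)
Definition clique_deriv s x i : R :=
  \sum_(A in cliques G s | i \in A) \prod_(k in A :\ i) x ord0 k.

Lemma clique_subset A B : is_clique G A -> B \subset A -> is_clique G B.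
Proof.
move=> /'forall_in_forall_inP clA sBA.
apply/'forall_in_forall_inP=> i Bi j Bj.
by apply: clA; apply: (fintype.subsetP sBA).
Qed.

Lemma clique_deriv_ge0 s x i :
  (forall k, 0 <= x ord0 k) -> 0 <= clique_deriv s x i.
Proof. by move=> x_ge0; apply: sumr_ge0 => A _; apply: prodr_ge0. Qed.

(** Every [(s+1)]-clique through [i] is an [s]-clique through [i] plus a vertex. *)
Lemma clique_deriv_eq0S s x i : (1 <= s)%N -> (forall k, 0 <= x ord0 k) ->
  clique_deriv s x i = 0 -> clique_deriv s.+1 x i = 0.
Proof.
move=> s_gt0 x_ge0 d0; apply: big1 => A /andP[+ Ai].
rewrite inE => /andP[clA /eqP cardA].
have : (0 < #|A :\ i|)%N by have := cardsD1 i A; rewrite Ai cardA add1n => -[<-].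
case/card_gt0P=> j Aij; rewrite (big_setD1 j Aij) /=.
have /andP[neq_ji Aj] : (j != i) && (j \in A) by move: Aij; rewrite !inE.
have -> : A :\ i :\ j = A :\ j :\ i by apply/setP=> k; rewrite !inE andbCA.
have clAj : A :\ j \in cliques G s.
  rewrite inE (clique_subset clA) ?subsetDl //=.
  by have := cardsD1 j A; rewrite Aj cardA add1n => -[<-].
have iAj : i \in A :\ j by rewrite !inE eq_sym neq_ji.
have /eqP := d0; rewrite psumr_eq0; last by move=> B _; apply: prodr_ge0.
move=> /allP/(_ (A :\ j)); rewrite mem_index_enum clAj iAj.
by move=> /(_ isT)/eqP ->; rewrite mulr0.
Qed.

Definition replace2 x i j (u v : R) : 'rV[R]_n :=
  \row_k if k == i then u else if k == j then v else x ord0 k.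

(** Non-adjacency excludes a term in [u * v], and neither the coefficients of [u]
    and [v] nor the remaining sum depends on the two replaced coordinates. *)
Lemma clique_sum_replace2 s x i j u v : i != j -> ~~ G i j ->
  clique_sum G s (replace2 x i j u v) =
  u * clique_deriv s x i + v * clique_deriv s x j +
  \sum_(A in cliques G s | (i \notin A) && (j \notin A)) \prod_(k in A) x ord0 k.
Proof.
move=> neq_ij nadj.
have not_both A : A \in cliques G s -> i \in A -> j \in A -> False.
  rewrite inE => /andP[/'forall_in_forall_inP clA _] Ai Aj.
  by have := clA i Ai j Aj; rewrite neq_ij (negPf nadj).
rewrite /clique_sum (bigID (fun A => i \in A)) /= -addrA; congr (_ + _).
  rewrite mulr_sumr; apply: eq_bigr => A /andP[clA Ai].
  rewrite (big_setD1 i Ai) /= mxE eqxx; congr (_ * _).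
  apply: eq_bigr => k; rewrite !inE mxE => /andP[/negPf -> Ak].
  by case: eqP Ak => // -> /(not_both A clA Ai).
rewrite (bigID (fun A => j \in A)) /=; congr (_ + _).
  rewrite mulr_sumr; apply: eq_big => A.
    rewrite -andbA; case clA: (A \in _) => //=.
    by case Ai : (i \in A) => //=; apply/esym/negP; exact: not_both.
  move=> /andP[/andP[clA Ai] Aj].
  rewrite (big_setD1 j Aj) /= mxE eqxx eq_sym (negPf neq_ij); congr (_ * _).
  apply: eq_bigr => k; rewrite !inE mxE => /andP[/negPf -> Ak].
  by case: eqP Ak Ai => // -> ->.
apply: eq_big => A; first by rewrite andbA.
move=> /andP[/andP[clA Ai] Aj]; apply: eq_bigr => k Ak; rewrite mxE.
by case: eqP Ak Ai => [-> -> // | _ Ak _]; case: eqP Ak Aj => [-> -> |].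
Qed.

(** Move along the line where [a t + b u] is constant.  If [a] and [b] are
    positive, all the weight goes to the coordinate with the larger ratio [c / a]
    or [d / b]; if one of them is zero, its coordinate contributes to neither
    form and can be set to [0]. *)
Lemma slide (a b c d t u : R) : 0 <= a -> 0 <= b -> 0 <= t -> 0 <= u ->
  (a = 0 -> c = 0) -> (b = 0 -> d = 0) ->
  exists t' u', [/\ 0 <= t', 0 <= u', t' = 0 \/ u' = 0,
    t' * a + u' * b = t * a + u * b & t * c + u * d <= t' * c + u' * d].
Proof.
move=> a_ge0 b_ge0 t_ge0 u_ge0 ac bd.
have [a0|a_neq0] := eqVneq a 0.
  by exists 0, u; split=> //; [left | rewrite a0; lra | rewrite (ac a0); lra].
have [b0|b_neq0] := eqVneq b 0.
  by exists t, 0; split=> //; [right | rewrite b0; lra | rewrite (bd b0); lra].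
have a_gt0 : 0 < a by rewrite lt0r a_neq0.
have b_gt0 : 0 < b by rewrite lt0r b_neq0.
have [le_cd|/ltW le_dc] := lerP (d * a) (c * b).
  exists (t + u * b / a), 0; split.
  - by rewrite addr_ge0 ?divr_ge0 ?mulr_ge0.
  - by [].
  - by right.
  - by field.
  rewrite mul0r addr0 mulrDl lerD2l.
  rewrite (_ : u * b / a * c = u * (c * b / a)); last by ring.
  by rewrite ler_wpM2l // ler_pdivlMr.
exists 0, (u + t * a / b); split.
- by [].
- by rewrite addr_ge0 ?divr_ge0 ?mulr_ge0.
- by left.
- by field.
rewrite mul0r add0r mulrDl addrC lerD2l.
rewrite (_ : t * a / b * d = t * (d * a / b)); last by ring.
by rewrite ler_wpM2l // ler_pdivlMr.
Qed.

(** Each application of [slide] to two non-adjacent vertices of the support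
    removes one of them from it. *)
Lemma supp_clique_reduction s x : (1 <= s)%N -> (forall i, 0 <= x ord0 i) ->
  exists y, [/\ forall i, 0 <= y ord0 i, is_clique G (supp y),
    clique_sum G s y = clique_sum G s x &
    clique_sum G s.+1 x <= clique_sum G s.+1 y].
Proof.
move=> s_gt0; have [m] := ubnP #|supp x|; elim: m x => // m IHm x.
rewrite ltnS => le_m x_ge0.
have [cl | ] := boolP (is_clique G (supp x)); first by exists x.
rewrite negb_forall_in => /exists_inP[i xi].
rewrite negb_forall_in => /exists_inP[j xj].
rewrite negb_imply => /andP[neq_ij nadj].
have x_eq : x = replace2 x i j (x ord0 i) (x ord0 j).
  apply/rowP=> k; rewrite mxE.
  by case: eqP => [-> //|_]; case: eqP => [->|].
have [t [u [t_ge0 u_ge0 tu0 eq_s le_s]]] := slide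
  (clique_deriv_ge0 s i x_ge0) (clique_deriv_ge0 s j x_ge0) (x_ge0 i) (x_ge0 j)
  (clique_deriv_eq0S s_gt0 x_ge0) (clique_deriv_eq0S s_gt0 x_ge0).
have y_ge0 k : 0 <= replace2 x i j t u ord0 k.
  by rewrite mxE; case: eqP => // _; case: eqP.
have [|//|y [? ? eq_y le_y]] := IHm (replace2 x i j t u).
  apply: leq_trans le_m; apply: proper_card; apply/properP; split.
    apply/fintype.subsetP=> k; rewrite !inE mxE.
    rewrite inE in xi; rewrite inE in xj.
    by case: (k =P i) => [->|_] //; case: (k =P j) => [->|].
  case: tu0 => [t0|u0]; [exists i | exists j] => //; rewrite inE mxE.
    by rewrite eqxx t0 eqxx.
  by rewrite [j == i]eq_sym (negPf neq_ij) eqxx u0 eqxx.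
exists y; split=> //.
  by rewrite eq_y [in RHS]x_eq !clique_sum_replace2 // eq_s.
apply: le_trans le_y.
by rewrite [in leLHS]x_eq !clique_sum_replace2 // lerD2r.
Qed.

(** A product over a vertex set that is not a clique has a zero factor, so that
    the sum may range over all [s]-sets. *)
Lemma clique_sum_supp s x : is_clique G (supp x) ->
  clique_sum G s x = (\prod_i (1 + x ord0 i *: 'X))`_s.
Proof.
move=> cl; under eq_bigr do rewrite addrC.
rewrite bigA_distr coef_sum /clique_sum big_mkcond /=.
apply: eq_bigr => A _; rewrite -big_mkcond /= scaler_prod prodr_const coefZ coefXn.
rewrite inE [s == _]eq_sym; case: (eqVneq #|A| s) => _; last by rewrite andbF mulr0.
rewrite andbT mulr1; have [//|nclA] := boolP (is_clique G A).
have /fintype.subsetPn[i Ai] : ~~ (A \subset supp x).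
  by apply: contra nclA; exact: clique_subset.
by rewrite inE negbK => /eqP xi0; rewrite (big_setD1 i Ai) /= xi0 mul0r.
Qed.

(** The support may be smaller than a maximum clique; appending zeros to reach
    length [clique_number G] gives the symmetric means the right normalization
    and leaves the elementary symmetric polynomials unchanged. *)
Lemma clique_density_supp x : is_clique G (supp x) ->
    (forall i, 0 <= x ord0 i) ->
  exists l : seq R, all (fun t => 0 <= t) l /\
    forall s, (s <= clique_number G)%N -> clique_density G s x = symmean l s.
Proof.
move=> cl x_ge0; set w := clique_number G.
have le_w : (#|supp x| <= w)%N by exact: leq_bigmax_cond.
pose l := [seq x ord0 i | i <- enum (supp x)] ++ nseq (w - #|supp x|) 0.
have size_l : size l = w by rewrite size_cat size_map -cardE size_nseq subnKC.
exists l; split=> [|s le_sw].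
  by rewrite all_cat all_nseq lexx orbT andbT; apply/allP=> _ /mapP[i _ ->].
have bin_neq0 : 'C(w, s)%:R != 0 :> R by rewrite pnatr_eq0 -lt0n bin_gt0.
apply: (mulIf bin_neq0); rewrite divfK // clique_sum_supp // mulrC -size_l.
rewrite -coef_prod_symmean.
rewrite big_cat big_map /= [X in _ * X]big_nseq.
rewrite scale0r addr0 iter_fix ?mulr1 // big_enum /=.
rewrite (bigID (mem (supp x))) /= [X in _ * X]big1 ?mulr1 // => i.
by rewrite inE negbK => /eqP ->; rewrite scale0r addr0.
Qed.

End CliqueSums.

Theorem mainTheorem1 (R : realType) (n : nat) (hn : (1 <= n)%N)
    (G : sgraph n) (x : 'rV[R]_n) (hx : forall i : 'I_n, 0 <= x ord0 i)
    (s : nat) (hs1 : (1 <= s)%N) (hs : (s < clique_number G)%N) :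
  clique_density G s x `^ (s%:R^-1) >=
  clique_density G s.+1 x `^ (s.+1%:R^-1).
Proof.
have [y [y_ge0 cl_y eq_s le_S]] := supp_clique_reduction G hs1 hx.
have [l [l_ge0 density_l]] := clique_density_supp cl_y y_ge0.
have density_ge0 k : 0 <= clique_density G k x.
  by rewrite divr_ge0 ?sumr_ge0 // => A _; apply: prodr_ge0.
have maclaurin_x :
    clique_density G s.+1 x ^+ s <= clique_density G s x ^+ s.+1.
  have -> : clique_density G s x = symmean l s.
    by rewrite -density_l 1?ltnW // /clique_density eq_s.
  apply: le_trans (maclaurin s l_ge0).
  rewrite lerXn2r ?nnegrE ?density_ge0 ?symmean_ge0 // -density_l //.
  by rewrite ler_wpM2r ?invr_ge0.
have root a k m : 0 <= a -> (0 < k)%N -> (0 < m)%N ->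
    (a ^+ k) `^ ((k * m)%:R^-1) = a `^ (m%:R^-1) :> R.
  move=> a_ge0 k_gt0 m_gt0; rewrite -powR_mulrn // -powRrM natrM invfM mulrA.
  by rewrite divff ?mul1r // pnatr_eq0 -lt0n.
(* Both sides are the [s (s + 1)]-th roots of the sides of [maclaurin_x]. *)
rewrite -(root _ s s.+1) // -(root _ s.+1 s) // [(s.+1 * s)%N]mulnC.
by rewrite ge0_ler_powR ?nnegrE ?exprn_ge0 ?invr_ge0.
Qed.
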